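(* Let $a,b$ be positive integers and $n\ge 0$. The number $h^{a,b}_n$ of tilings of the honeycomb strip $H_n$ by monomers of $a$ colors and dimers of $b$ colors satisfies $$h^{a,b}_n=\sum_{k=0}^{\lfloor n/2\rfloor}c_{n,k}\,a^{n-2k}b^k=\sum_{k=0}^{\lfloor n/2\rfloor}\sum_{m=0}^{k}\binom{n-k-m}{m}\binom{n-k-m}{k-m}a^{n-2k}b^k,$$ where $c_{n,k}$ is the number of (uncolored) tilings of $H_n$ with exactly $k$ dimers and $n-2k$ monomers.
   Context: The honeycomb strip $H_n$ consists of $n$ regular hexagons arranged in two rows, numbered $1,\dots,n$ from the bottom left so that odd-numbered hexagons form the bottom row and even-numbered ones the top row; hexagon $i$ shares an edge with hexagons $i\pm1$ and $i\pm2$ (when they exist), and with no others. A monomer is a single hexagon; a dimer is a pair of edge-adjacent hexagons, i.e. either $\{i,i+1\}$ (slanted) or $\{i,i+2\}$ (horizontal). A tiling of $H_n$ is a partition of its hexagons into monomers and dimers; in a colored tiling each monomer receives one of $a$ colors and each dimer one of $b$ colors. Binomial coefficients with lower index negative or exceeding the upper index are $0$. *)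

(* Defs.v *)
From mathcomp Require Import all_boot.

Set Implicit Arguments.
Unset Strict Implicit.
Unset Printing Implicit Defensive.

(* The hexagons of H_n are the elements of 'I_n; hexagon i + 1 of the strip is
   the ordinal of value i. *)
Definition hex_adj n (i j : 'I_n) : bool :=
  [|| i + 1 == j, j + 1 == i, i + 2 == j | j + 2 == i].

Definition is_monomer n (B : {set 'I_n}) : bool := [exists i, B == [set i]].

Definition is_dimer n (B : {set 'I_n}) : bool :=
  [exists i, exists j, hex_adj i j && (B == [set i; j])].

Definition is_tiling n (P : {set {set 'I_n}}) : bool :=
  partition P [set: 'I_n] && [forall B in P, is_monomer B || is_dimer B].

Definition monomers n (P : {set {set 'I_n}}) := [set B in P | is_monomer B].
Definition dimers n (P : {set {set 'I_n}}) := [set B in P | is_dimer B].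

Definition tiling_number n k : nat :=
  #|[set P : {set {set 'I_n}} |
      [&& is_tiling P, #|dimers P| == k & #|monomers P| == n - 2 * k]]|.

Definition tiling n := {P : {set {set 'I_n}} | is_tiling P}.

Definition coloring a b n (P : {set {set 'I_n}}) : finType :=
  ({ffun {B | B \in monomers P} -> 'I_a} *
   {ffun {B | B \in dimers P} -> 'I_b})%type.

Definition colored_tiling a b n : finType :=
  {P : tiling n & coloring a b (val P)}.

Definition colored_tiling_number a b n : nat := #|{: colored_tiling a b n}|.

(* Main.v *)
(** Tilings of a set of hexagons satisfy a deletion recurrence: split on the tile
    covering a given hexagon.  Applied to the leftmost hexagon of the strip (and
    once more to the second one when the first tile is {1, 3}), it decomposes a
    tiling into indecomposable pieces of lengths 1, 2, 3, 4 with 0, 1, 1, 2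
    dimers, so the generating function is
      1 / (1 - x - x^2 y - x^3 y - x^4 y^2) = 1 / (1 - x (1 + x y) (1 + x^2 y)).
    The factorization explains the binomial sum: the coefficient of x^n y^k picks
    m factors x^2 y and k - m factors x y among j = n - k - m pieces.  Expanding
    both binomials by Pascal's rule gives the same four-term recurrence. *)
Require Import Defs.
From mathcomp Require Import all_boot.
From mathcomp Require Import zify.

Set Implicit Arguments.
Unset Strict Implicit.
Unset Printing Implicit Defensive.

Lemma card_setId_sum (T : finType) (S : {set T}) (p : pred T) :
  #|[set x in S | p x]| = \sum_(x in S) p x.
Proof.
by rewrite -sum1dep_card big_mkcondr; apply: eq_bigr => x _; case: (p x).
Qed.

(** * Tiles and tilings of an arbitrary set of hexagons *)

Section Tilings.

Variable n : nat.
Implicit Types (i j x y : 'I_n) (A B C : {set 'I_n}) (P Q : {set {set 'I_n}}).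

Lemma hex_adj_sym x y : hex_adj x y = hex_adj y x.
Proof. rewrite /hex_adj; lia. Qed.

Lemma hex_adj_neq x y : hex_adj x y -> x != y.
Proof. by apply: contraTneq => ->; rewrite /hex_adj; lia. Qed.

Lemma is_monomerE B : is_monomer B = (#|B| == 1).
Proof.
by apply/existsP/cards1P => [[i /eqP->]|[i ->]]; exists i.
Qed.

Lemma is_dimerP B :
  reflect (exists i, exists2 j, hex_adj i j & B = [set i; j]) (is_dimer B).
Proof.
apply: (iffP existsP) => [[i /existsP[j /andP[ij /eqP->]]]|[i [j ij ->]]].
  by exists i, j.
by exists i; apply/existsP; exists j; rewrite ij eqxx.
Qed.

Lemma is_dimer_card B : is_dimer B -> #|B| = 2.
Proof.
by case/is_dimerP => i [j ij ->]; rewrite cards2 (hex_adj_neq ij).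
Qed.

Lemma is_dimer_set1 x : is_dimer [set x] = false.
Proof. by apply/negbTE/negP => /is_dimer_card; rewrite cards1. Qed.

Lemma is_dimer_set2 x y : hex_adj x y -> is_dimer [set x; y].
Proof. by move=> xy; apply/is_dimerP; exists x, y. Qed.

Lemma is_dimer_mem B x :
  is_dimer B -> x \in B -> exists2 y, hex_adj x y & B = [set x; y].
Proof.
case/is_dimerP => i [j ij ->]; rewrite !inE => /orP[/eqP->|/eqP->].
  by exists j.
by exists i; rewrite 1?hex_adj_sym // setUC.
Qed.

Lemma set2_injr x y z : [set x; y] = [set x; z] -> x != y -> y = z.
Proof.
move=> /setP /(_ y); rewrite !inE eqxx orbT => /esym /orP[/eqP->|/eqP//].
by rewrite eqxx.
Qed.

Definition is_tile B := is_monomer B || is_dimer B.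

(** The region is arbitrary because deleting a tile from a strip need not leave a strip. Only dimers
    are tracked: by [partition_tile_card] they determine the number of monomers. *)
Definition tilings_of A k : {set {set {set 'I_n}}} :=
  [set P | [&& partition P A, [forall B in P, is_tile B] & #|dimers P| == k]].

Lemma tilings_ofP A k P :
  reflect [/\ partition P A, {in P, forall B, is_tile B} & #|dimers P| = k]
          (P \in tilings_of A k).
Proof.
rewrite inE; apply: (iffP and3P) => -[? H ?]; split=> //; try exact/eqP.
  by move=> B BP; move/forall_inP: H; apply.
by apply/forall_inP.
Qed.

Lemma partition_tile_card P A :
  partition P A -> {in P, forall B, is_tile B} ->
  #|A| = #|monomers P| + 2 * #|dimers P|.
Proof.
move=> partP tileP; rewrite (card_partition partP).
rewrite !card_setId_sum big_distrr -big_split; apply: eq_bigr => B /tileP.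
rewrite /is_tile is_monomerE; case dB: (is_dimer B).
  by rewrite (is_dimer_card dB).
by rewrite orbF => /eqP->.
Qed.

(** Removing [B] from a tiling and adding it back are mutually inverse; [is_dimer B], read as 0 or
    1, accounts for the dimer lost. *)
Lemma card_tilings_of_block A B k :
  B \subset A -> is_tile B ->
  #|[set P in tilings_of A (is_dimer B + k) | B \in P]|
    = #|tilings_of (A :\: B) k|.
Proof.
move=> sBA tileB.
have B_neq0 : B != set0.
  rewrite -card_gt0; case/orP: tileB; first by rewrite is_monomerE => /eqP->.
  by move/is_dimer_card->.
have notin Q : partition Q (A :\: B) -> B \notin Q.
  move=> partQ; apply/negP => BQ.
  have /subsetP sB : B \subset A :\: B.
    by rewrite -(cover_partition partQ); apply: bigcup_sup.
  by case/set0Pn: B_neq0 => z zB; have:= sB z zB; rewrite inE zB.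
have dimU Q : B \notin Q -> #|dimers (B |: Q)| = is_dimer B + #|dimers Q|.
  move=> BQ; case dB : (is_dimer B).
    have -> : dimers (B |: Q) = B |: dimers Q.
      by apply/setP=> C; rewrite !inE; case: eqVneq => [->|].
    by rewrite cardsU1 inE (negPf BQ).
  congr #|pred_of_set _|; apply/setP=> C; rewrite !inE.
  by case: eqVneq => [->|//]; rewrite dB !andbF.
(* Two goals follow: the image of the insertion of [B] is the set of tilings of [A] containing [B],
   and the insertion is injective since [B] is never already a block. *)
rewrite -(card_in_imset (f := fun Q => B |: Q) (D := mem (tilings_of (A :\: B) k))).
  congr #|pred_of_set _|; apply/setP=> P; rewrite !inE.
  apply/idP/imsetP => [/andP[PS BP]|[Q /tilings_ofP[partQ tileQ dQ] ->]].
    have {PS} /tilings_ofP[partP tileP dP] : P \in tilings_of A (is_dimer B + k).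
      by rewrite inE.
    exists (P :\ B); last by rewrite setD1K.
    have partD := partitionD1 partP BP.
    apply/tilings_ofP; split=> //.
      by move=> C; rewrite !inE => /andP[_]; apply: tileP.
    have := dimU _ (notin _ partD); rewrite setD1K // dP.
    by move/addnI.
  rewrite setU11 andbT; suff: B |: Q \in tilings_of A (is_dimer B + k) by rewrite inE.
  apply/tilings_ofP; split.
  - have -> : A = B :|: (A :\: B).
      by rewrite -[LHS](setID A B) (setIidPr sBA).
    apply: partitionU1 => //.
    by rewrite -setI_eq0; apply/eqP/setP=> z; rewrite !inE; case: (z \in B).
  - by move=> C; rewrite !inE => /orP[/eqP->//|]; apply: tileQ.
  - by rewrite dimU ?dQ // notin.
move=> Q1 Q2 /tilings_ofP[p1 _ _] /tilings_ofP[p2 _ _] E.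
by rewrite -(setU1K (notin _ p1)) E setU1K // notin.
Qed.

(** * The deletion recurrence at a hexagon *)

Lemma tilings_of_block_split A k P x :
  P \in tilings_of A k -> x \in A ->
  ([set x] \in P) + \sum_(y in A | hex_adj x y) ([set x; y] \in P) = 1.
Proof.
case/tilings_ofP => partP tileP _ xA.
have cP := cover_partition partP.
have [_ tI _] := and3P partP.
have uniq B C : B \in P -> C \in P -> x \in B -> x \in C -> B = C.
  by move=> BP CP xB xC; rewrite -(def_pblock tI BP xB) (def_pblock tI CP xC).
set B := pblock P x.
have BP : B \in P by rewrite pblock_mem // cP.
have xB : x \in B by rewrite mem_pblock cP.
have sBA : B \subset A by rewrite -cP; apply: (bigcup_sup B).
have /orP[mB|dB] := tileP _ BP.
  have EB : B = [set x].
    move: mB => /existsP[i /eqP Bi]; move: xB; rewrite Bi inE.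
    by move=> /eqP->.
  have -> : [set x] \in P by rewrite -EB.
  rewrite big1 // => y /andP[_ xy]; apply/eqP; rewrite eqb0.
  apply/negP => yP; have := uniq _ _ BP yP xB (set21 _ _).
  rewrite EB => E; have := is_dimer_set2 xy.
  by rewrite -E is_dimer_set1.
have [y xy EB] := is_dimer_mem dB xB.
have yA : y \in A by apply: (subsetP sBA); rewrite EB set22.
have -> : ([set x] \in P) = false.
  apply/negP => xP; have E := uniq _ _ BP xP xB (set11 _).
  by move: dB; rewrite E is_dimer_set1.
rewrite (bigD1 y) /= ?yA // -EB BP big1 // => z /andP[/andP[_ xz] zy].
apply/eqP; rewrite eqb0; apply: contra zy => zP.
have := uniq _ _ BP zP xB (set21 _ _); rewrite EB => E.
by rewrite (set2_injr E) // hex_adj_neq.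
Qed.

Definition tile_count A k := #|tilings_of A k|.

(** Double counting: exactly one tile covers [x], so each tiling's contribution 1 is replaced by the
    sum of [tilings_of_block_split], and the two summations are exchanged. *)
Lemma card_tilings_of_mem A k x : x \in A ->
  tile_count A k = #|[set P in tilings_of A k | [set x] \in P]| +
   \sum_(y in A | hex_adj x y) #|[set P in tilings_of A k | [set x; y] \in P]|.
Proof.
move=> xA; rewrite /tile_count -sum1_card.
rewrite -(eq_bigr _ (fun P PS => tilings_of_block_split PS xA)).
rewrite big_split exchange_big card_setId_sum; congr (_ + _).
by apply: eq_bigr => y _; rewrite card_setId_sum.
Qed.

Lemma tile_count0 A x : x \in A -> tile_count A 0 = tile_count (A :\ x) 0.
Proof.
move=> xA; rewrite (card_tilings_of_mem _ xA) big1 ?addn0; last first.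
  move=> y /andP[_ xy]; apply/eqP; rewrite cards_eq0; apply/eqP/setP=> P.
  rewrite [RHS]inE; apply/negP; rewrite inE => /andP[/tilings_ofP[_ _ /eqP]].
  rewrite cards_eq0 => /eqP/setP/(_ [set x; y]).
  by rewrite !inE is_dimer_set2 // andbT => ->.
have := @card_tilings_of_block A [set x] 0.
by rewrite is_dimer_set1 sub1set; apply=> //; rewrite /is_tile is_monomerE cards1.
Qed.

Lemma tile_countS A k x : x \in A ->
  tile_count A k.+1 = tile_count (A :\ x) k.+1 +
    \sum_(y in A | hex_adj x y) tile_count (A :\: [set x; y]) k.
Proof.
move=> xA; rewrite (card_tilings_of_mem _ xA); congr (_ + _).
  have := @card_tilings_of_block A [set x] k.+1.
  by rewrite is_dimer_set1 sub1set; apply=> //; rewrite /is_tile is_monomerE cards1.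
apply: eq_bigr => y /andP[yA xy].
have := @card_tilings_of_block A [set x; y] k; rewrite is_dimer_set2 //.
apply; first by rewrite subUset !sub1set xA.
by rewrite /is_tile is_dimer_set2 // orbT.
Qed.

Lemma tile_count_small A k : #|A| < 2 * k -> tile_count A k = 0.
Proof.
move=> lt; apply/eqP; rewrite cards_eq0; apply/eqP/setP=> P; rewrite [RHS]inE.
apply/negP => /tilings_ofP[/partition_tile_card/[apply]]; lia.
Qed.

(** Without dimers every hexagon can be deleted as a monomer, down to the empty region, whose only
    partition is empty. *)
Lemma tile_count_k0 A : tile_count A 0 = 1.
Proof.
have [m] := ubnP #|A|; elim: m A => // m IH A ltA.
have [->|[x xA]] := set_0Vmem A.
  apply/eqP/cards1P; exists set0; apply/setP=> P; rewrite [RHS]inE.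
  apply/tilings_ofP/eqP => [[]|->]; first by rewrite partition_set0 => /eqP.
  split; first by rewrite partition_set0.
    by move=> B; rewrite inE.
  by apply/eqP; rewrite cards_eq0; apply/eqP/setP=> B; rewrite !inE.
rewrite (tile_count0 xA) IH //; by move: ltA; rewrite (cardsD1 x A) xA.
Qed.


(** * Shorter strips, realized as suffixes inside the fixed type ['I_n] *)

Definition suffix r : {set 'I_n} := [set i : 'I_n | n <= i + r].

(* What is left of [suffix r.+3] once its first and third hexagons are tiled. *)
Definition gapped_suffix r : {set 'I_n} :=
  [set i : 'I_n | (i + r.+2 == n) || (n <= i + r)].

Lemma card_suffix r : r <= n -> #|suffix r| = r.
Proof.
elim: r => [_|r IH ltrn].
  apply/eqP; rewrite cards_eq0; apply/eqP/setP=> i.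
  by rewrite !inE; have := ltn_ord i; lia.
have lt : n - r.+1 < n by lia.
have -> : suffix r.+1 = Ordinal lt |: suffix r.
  by apply/setP=> i; rewrite !inE -val_eqE /=; lia.
by rewrite cardsU1 inE /= IH; lia.
Qed.

Lemma tile_count_suffix2 : 2 <= n -> tile_count (suffix 2) 1 = 1.
Proof.
move=> le2n.
have ltx : n - 2 < n by lia.
have lty : n - 1 < n by lia.
rewrite (@tile_countS _ _ (Ordinal ltx)); last by rewrite inE /=; lia.
have -> : suffix 2 :\ Ordinal ltx = suffix 1.
  by apply/setP=> i; rewrite !inE -val_eqE /=; lia.
rewrite tile_count_small ?card_suffix //; last lia.
rewrite (bigD1 (Ordinal lty)) /=; last by rewrite !inE /hex_adj /=; lia.
rewrite tile_count_k0 big1 // => y; rewrite !inE /hex_adj -val_eqE /=.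
by have := ltn_ord y; lia.
Qed.

(** The leftmost hexagon is a monomer or is paired at distance 1 or 2, its left neighbors being
    outside the suffix. Pairing at distance 2 leaves the gap. *)
Lemma tile_count_suffix r k : r.+3 <= n ->
  tile_count (suffix r.+3) k.+1 =
  tile_count (suffix r.+2) k.+1 + tile_count (suffix r.+1) k
    + tile_count (gapped_suffix r) k.
Proof.
move=> ltrn.
have ltx : n - r.+3 < n by lia.
have lty : n - r.+2 < n by lia.
have ltz : n - r.+1 < n by lia.
rewrite (@tile_countS _ _ (Ordinal ltx)); last by rewrite inE /=; lia.
rewrite (bigD1 (Ordinal lty)) /=; last by rewrite !inE /hex_adj /=; lia.
rewrite (bigD1 (Ordinal ltz)) /=; last first.
  by rewrite !inE /hex_adj -val_eqE /=; lia.
rewrite big1 ?addn0; last first.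
  by move=> y; rewrite !inE /hex_adj -!val_eqE /=; have := ltn_ord y; lia.
rewrite addnA; congr (tile_count _ _ + tile_count _ _ + tile_count _ _).
- by apply/setP=> i; rewrite !inE -!val_eqE /=; lia.
- by apply/setP=> i; rewrite !inE -!val_eqE /=; lia.
- by apply/setP=> i; rewrite !inE -!val_eqE /=; lia.
Qed.

(** The detached first hexagon has lost its neighbor at distance 1, so it is a monomer or is paired
    at distance 2. The index [r.+1] guarantees that this partner exists. *)
Lemma tile_count_gapped_suffix r k : r.+3 <= n ->
  tile_count (gapped_suffix r.+1) k.+1 =
  tile_count (suffix r.+1) k.+1 + tile_count (suffix r) k.
Proof.
move=> ltrn.
have ltx : n - r.+3 < n by lia.
have lty : n - r.+1 < n by lia.
rewrite (@tile_countS _ _ (Ordinal ltx)); last by rewrite inE /=; lia.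
rewrite (bigD1 (Ordinal lty)) /=; last by rewrite !inE /hex_adj /=; lia.
rewrite big1 ?addn0; last first.
  by move=> y; rewrite !inE /hex_adj -!val_eqE /=; have := ltn_ord y; lia.
congr (tile_count _ _ + tile_count _ _).
- by apply/setP=> i; rewrite !inE -!val_eqE /=; lia.
- by apply/setP=> i; rewrite !inE -!val_eqE /=; lia.
Qed.

End Tilings.

(** * The binomial sum and its four-term recurrence *)

Definition binomial_count n k :=
  \sum_(m < k.+1) 'C(n - k - m, m) * 'C(n - k - m, k - m).

Lemma binomial_count_small n k : n < 2 * k -> binomial_count n k = 0.
Proof.
move=> lt; rewrite /binomial_count big1 // => -[m /= ltm] _.
(* The split is needed at [m = k], where the second binomial is 1 and the first one must vanish. *)
have [lt1|le1] := ltnP (n - k - m) m; first by rewrite bin_small.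
by rewrite [X in _ * X]bin_small ?muln0 //; lia.
Qed.

Lemma binomial_count_k0 n : binomial_count n 0 = 1.
Proof. by rewrite /binomial_count big_ord1 !bin0. Qed.

Lemma binomial_count_k1 n : binomial_count n.+2 1 = n.*2.+1.
Proof.
rewrite /binomial_count big_ord_recr big_ord1 /= !subn0 !subn1 /=.
rewrite !bin0 !bin1; lia.
Qed.

(* The side condition excludes only j = m = 0, where 'C(0.-1, 0) = 1. *)
Lemma bin_pred j m :
  (0 < j) || (0 < m) -> 'C(j, m.+1) = 'C(j.-1, m.+1) + 'C(j.-1, m).
Proof. by case: j m => [|j] [|m] //= _; rewrite binS. Qed.

(** Pascal's rule on both factors of an interior term gives four products, one for each count on the
    right; the extreme values of the summation index have one nontrivial factor and are treated
    apart. *)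
Lemma binomial_countS n k :
  binomial_count n.+4 k.+2 =
  binomial_count n.+3 k.+2 + binomial_count n.+2 k.+1
    + binomial_count n.+1 k.+1 + binomial_count n k.
Proof.
(* All sums are reindexed to the common upper index [n - k - m]; [a] and [b] record the lower
   indices, each shifted by one or not. *)
pose s (a b : nat -> nat) :=
  \sum_(m < k.+1) 'C(n - k - m, a m) * 'C(n - k - m, b m).
have -> : binomial_count n k = s id (fun m => k - m) by [].
have -> : binomial_count n.+1 k.+1 =
    s id (fun m => (k - m).+1) + 'C((n - k - k).-1, k.+1).
  rewrite /binomial_count big_ord_recr /= subnn bin0 muln1; congr (_ + _).
    by apply: eq_bigr => -[m /= ltm] _; rewrite subSS subSn.
  by congr 'C(_, _); lia.
have -> : binomial_count n.+2 k.+1 =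
    'C(n.+1 - k, k.+1) + s S (fun m => k - m).
  rewrite /binomial_count big_ord_recl /= bin0 mul1n subn0 subSS; congr (_ + _).
  apply: eq_bigr => -[m /= ltm] _; rewrite /bump add1n subSS.
  by have -> : n.+1 - k - m.+1 = n - k - m by lia.
have -> : binomial_count n.+3 k.+2 =
    'C(n.+1 - k, k.+2) + s S (fun m => (k - m).+1) + 'C((n - k - k).-1, k.+2).
  rewrite /binomial_count big_ord_recl big_ord_recr /= bin0 mul1n subn0 !subSS.
  rewrite /bump !add1n subnn bin0 muln1 addnA; congr (_ + _ + _).
    apply: eq_bigr => -[m /= ltm] _; rewrite add1n subSS [k.+1 - m]subSn //.
    by have -> : n.+1 - k - m.+1 = n - k - m by lia.
  by congr 'C(_, _); lia.
have -> : binomial_count n.+4 k.+2 =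
    ('C(n.+1 - k, k.+2) + 'C(n.+1 - k, k.+1)) +
    \sum_(m < k.+1) ('C(n - k - m, m.+1) + 'C(n - k - m, m)) *
                    ('C(n - k - m, (k - m).+1) + 'C(n - k - m, k - m)) +
    ('C((n - k - k).-1, k.+2) + 'C((n - k - k).-1, k.+1)).
  rewrite /binomial_count big_ord_recl big_ord_recr /= bin0 mul1n subn0 !subSS.
  rewrite /bump !add1n subnn bin0 muln1 addnA; congr (_ + _ + _).
  - rewrite subn0 bin_pred ?orbT //.
    by have -> : (n.+2 - k).-1 = n.+1 - k by lia.
  - apply: eq_bigr => -[m /= ltm] _; rewrite add1n subSS [k.+1 - m]subSn //.
    have -> : n - k - m = (n.+2 - k - m.+1).-1 by lia.
    (* At upper index 0 Pascal's rule fails for a lower index 0, but the identity for the product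
       breaks only if [m] and [k - m] are both 0. Then [k = 0] and the upper index is [n.+1], a
       contradiction. *)
    have [lt0|] := ltnP 0 (n.+2 - k - m.+1).
      by rewrite (@bin_pred _ m) ?lt0 // (@bin_pred _ (k - m)) ?lt0.
    rewrite leqn0 => /eqP E; rewrite E /= !bin0n.
    by have [|] := eqVneq m 0; have [|] := eqVneq (k - m) 0 => //=; lia.
  - rewrite bin_pred ?orbT //.
    by have -> : (n.+2 - k - k.+2).-1 = (n - k - k).-1 by lia.
have -> : \sum_(m < k.+1) ('C(n - k - m, m.+1) + 'C(n - k - m, m)) *
                    ('C(n - k - m, (k - m).+1) + 'C(n - k - m, k - m)) =
    s S (fun m => (k - m).+1) + s S (fun m => k - m) +
    s id (fun m => (k - m).+1) + s id (fun m => k - m).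
  rewrite /s -!big_split; apply: eq_bigr => m _ /=; rewrite mulnDl !mulnDr; lia.
lia.
Qed.

(** * Agreement of the tiling count with the binomial sum *)

Lemma tile_count_suffixE n r k :
  r <= n -> tile_count (suffix n r) k = binomial_count r k.
Proof.
have [N] := ubnP r; elim: N r k => // N IH r k ltrN lern.
case: k => [|[|k]]; first by rewrite tile_count_k0 binomial_count_k0.
(* With a single dimer, a horizontal first tile leaves no dimer for the gapped suffix, which then
   counts 1. *)
- case: r ltrN lern => [|[|[|r]]] ltrN lern.
  + by rewrite tile_count_small ?binomial_count_small ?card_suffix.
  + by rewrite tile_count_small ?binomial_count_small ?card_suffix.
  + by rewrite tile_count_suffix2 // binomial_count_k1.
  + rewrite tile_count_suffix // !tile_count_k0 IH; try lia.
    by rewrite !binomial_count_k1; lia.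
- have [lt4|le4] := ltnP r 4.
    by rewrite tile_count_small ?binomial_count_small ?card_suffix //; lia.
  case: r le4 ltrN lern => [|[|[|[|r]]]] // _ ltrN lern.
  (* Eliminating the gapped suffix yields exactly the recurrence of [binomial_countS]. *)
  rewrite tile_count_suffix // tile_count_gapped_suffix; last lia.
  by rewrite !IH ?binomial_countS; lia.
Qed.

(** The prescribed number of monomers follows from the number of dimers, since the tiles cover all
    [n] hexagons. *)
Lemma tiling_numberE n k :
  2 * k <= n -> tiling_number n k = binomial_count n k.
Proof.
move=> le2k; rewrite -(tile_count_suffixE _ (leqnn n)).
have -> : suffix n n = [set: 'I_n] by apply/setP=> i; rewrite !inE leq_addl.
apply: eq_card => P; rewrite !inE /is_tiling -andbA; apply: andb_id2l => partP.
apply: andb_id2l => /forall_inP tileP; case: eqP => //= dk.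
have := partition_tile_card partP tileP; rewrite dk cardsT card_ord => En.
by apply/eqP; rewrite -(addnK (2 * k) #|_|) -En.
Qed.

(** * Counting colored tilings *)

Lemma card_coloring a b n (P : {set {set 'I_n}}) :
  #|{: coloring a b P}| = a ^ #|monomers P| * b ^ #|dimers P|.
Proof. by rewrite card_prod !card_ffun !card_ord !card_sig. Qed.

Lemma colored_tiling_numberE a b n :
  colored_tiling_number a b n =
  \sum_(0 <= k < (n %/ 2).+1) tiling_number n k * a ^ (n - 2 * k) * b ^ k.
Proof.
have cardP (P : {set {set 'I_n}}) : is_tiling P ->
    #|monomers P| = n - 2 * #|dimers P| /\ #|dimers P| < (n %/ 2).+1.
  move=> /andP[partP /forall_inP tileP].
  have aux m d : n = m + 2 * d -> m = n - 2 * d /\ d < (n %/ 2).+1 by lia.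
  by apply: aux; rewrite -(partition_tile_card partP tileP) cardsT card_ord.
rewrite /colored_tiling_number card_tagged sumnE big_map big_enum /=.
under eq_bigr => P _ do rewrite card_coloring.
rewrite big_mkord.
(* The sum over the subtype of tilings becomes a filtered sum over all families of sets, the form
   used in [tiling_number]. *)
have -> : \sum_(P : tiling n) a ^ #|monomers (val P)| * b ^ #|dimers (val P)| =
    \sum_(P : {set {set 'I_n}} | is_tiling P) a ^ #|monomers P| * b ^ #|dimers P|.
  rewrite [RHS](reindex_omap (J := tiling n) val insub) => [|P tP]; last by rewrite insubT.
  by apply: eq_bigl => P; rewrite valK eqxx (valP P).
(* Tilings are grouped by number of dimers; [inord] loses nothing because [cardP] bounds that number
   by [n %/ 2]. *)
rewrite (partition_big (fun P => inord #|dimers P| : 'I_(n %/ 2).+1) predT) //=.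
apply: eq_bigr => k _; rewrite -mulnA /tiling_number -sum_nat_const.
apply: eq_big => [P|P].
  rewrite inE; apply: andb_id2l => /cardP[Em ltd].
  by rewrite -val_eqE /= inordK //; case: eqP => // <-; rewrite Em eqxx.
case/andP=> /cardP[Em ltd].
by rewrite -val_eqE /= inordK // => /eqP <-; rewrite Em.
Qed.

Theorem theorem4 (a b n : nat) (ha : 0 < a) (hb : 0 < b) :
  colored_tiling_number a b n =
    \sum_(0 <= k < (n %/ 2).+1) tiling_number n k * a ^ (n - 2 * k) * b ^ k
  /\
  \sum_(0 <= k < (n %/ 2).+1) tiling_number n k * a ^ (n - 2 * k) * b ^ k =
    \sum_(0 <= k < (n %/ 2).+1) \sum_(0 <= m < k.+1)
      'C(n - k - m, m) * 'C(n - k - m, k - m) * a ^ (n - 2 * k) * b ^ k.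
Proof.
split; first exact: colored_tiling_numberE.
apply: eq_big_nat => k /andP[_ ltk]; rewrite tiling_numberE; last lia.
by rewrite big_mkord -!big_distrl.
Qed.
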